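(* Let $D_1=(V_1,\vec{E}_1)$ and $D_2=(V_2,\vec{E}_2)$ be two directed acyclic graphs with finite node sets, and run the algorithm FUSE_DAGS on input $(D_1,D_2)$. Then no directed cycle is created in $D^*$ and no directed cycle is created in $D_2$ during any iteration of either of the two loops of the algorithm. Consequently, the sequence of arc reversals performed by the algorithm in transforming $D_2$ into $D_2'$ is valid, i.e. $D_2$ is acyclic after each of these reversals.
   Context: All graphs are directed, on finite node sets. An arc $(x,y)$ points from $x$ to $y$. For a directed graph $D=(V,\vec{E})$ and $x\in V$, put $P_D(x)=\{y\in V : (y,x)\in\vec{E}\}$ (direct predecessors). A DAG is a directed acyclic graph. A directed cycle may have any positive length (loops and 2-cycles included). Topological value: for a DAG $D=(V,\vec{E})$, $\tau_D:V\to\mathbb{N}$ is defined recursively by $\tau_D(x)=0$ if $P_D(x)=\emptyset$, and $\tau_D(x)=1+\max\{\tau_D(y): y\in P_D(x)\}$ otherwise (the length of the longest directed path ending at $x$). Arc reversal: reversing an arc $(x,y)$ of a directed graph $D$ replaces $(x,y)$ by $(y,x)$ and adds the arcs of $C_x=\{(z,x): z\in P_D(y)\setminus P_D(x),\ z\neq x\}$ and $C_y=\{(z,y): z\in P_D(x)\setminus P_D(y)\}$, where $P_D$ is taken before the reversal. A sequence of arc reversals is valid if the graph is acyclic after each reversal. The algorithm FUSE_DAGS, on input DAGs $D_1=(V_1,\vec{E}_1)$, $D_2=(V_2,\vec{E}_2)$, maintains graphs $D^*=(V_1\cup V_2,\vec{E^*})$ and $D_2=(V_2,\vec{E}_2)$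 (both changing over time) and sets of arcs $DIR$, $REV$, $EQ$. The values $\tau_{D^*}$ and $\tau_{D_2}$ always refer to the current graphs. Initialization: $\vec{E^*}=\vec{E}_1$; $DIR=\{(x,y)\in\vec{E}_2:(x,y)\notin\vec{E^*},\ \tau_{D^*}(x)<\tau_{D^*}(y)\}$; $REV=\{(x,y)\in\vec{E}_2:\tau_{D^*}(x)>\tau_{D^*}(y)\}$; $EQ=\{(x,y)\in\vec{E}_2:\tau_{D^*}(x)=\tau_{D^*}(y)\}$. Priority orders (minimal elements are selected first, remaining ties broken arbitrarily): $(x_1,y_1)<_{REV}(x_2,y_2)$ if $\tau_{D_2}(y_1)<\tau_{D_2}(y_2)$, or $\tau_{D_2}(y_1)=\tau_{D_2}(y_2)$ and $\tau_{D_2}(x_1)\ge\tau_{D_2}(x_2)$. $(x_1,y_1)<_{EQ}(x_2,y_2)$ if $\tau_{D^*}(x_1)>\tau_{D^*}(x_2)$, or $\tau_{D^*}(x_1)=\tau_{D^*}(x_2)$ and $\tau_{D_2}(y_1)\ge\tau_{D_2}(y_2)$. First loop. Until $REV=\emptyset$: select a minimal $(x,y)\in REV$ with respect to $<_{REV}$; delete it from $REV$; add $(y,x)$ to $\vec{E^*}$; let $C_x=\{(z,x): z\in P_{D_2}(y)\setminus P_{D_2}(x),\ z\neq x\}$ and $C_y=\{(z,y): z\in P_{D_2}(x)\setminus P_{D_2}(y)\}$ for the current $D_2$; put each arc $(z,w)\in C_x\cup C_y$ into $DIR$ if $\tau_{D^*}(z)<\tau_{D^*}(w)$, into $REV$ if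 $\tau_{D^*}(z)>\tau_{D^*}(w)$, and into $EQ$ if $\tau_{D^*}(z)=\tau_{D^*}(w)$; then reverse $(x,y)$ in $D_2$, i.e. $\vec{E}_2\leftarrow(\vec{E}_2\cup C_x\cup C_y\cup\{(y,x)\})\setminus\{(x,y)\}$. Second loop. Until $EQ=DIR=\emptyset$: $\vec{E^*}\leftarrow\vec{E^*}\cup DIR$; $DIR\leftarrow\emptyset$; then, if $EQ\ne\emptyset$, select a minimal $(x,y)\in EQ$ with respect to $<_{EQ}$; delete it from $EQ$; add $(x,y)$ to $\vec{E^*}$; set $DIR\leftarrow\{(z,y):(z,y)\in EQ\}$ and $EQ\leftarrow EQ\setminus DIR$. Output: the final $D^*$, and the final $D_2$, denoted $D_2'=(V_2,\vec{E}_2')$. *)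

(* Defs.v *)
From mathcomp Require Import all_boot.

Set Implicit Arguments.
Unset Strict Implicit.
Unset Printing Implicit Defensive.

Section Digraphs.

Variable T : finType.

(* Node sets are finite subsets of an ambient finite type, so that digraphs
   with different, possibly overlapping, node sets can be united. *)
Record digraph := Digraph { nodes : {set T}; arcs : {set T * T} }.

Implicit Types (D : digraph) (a b : T * T).

Definition is_digraph D : bool := arcs D \subset setX (nodes D) (nodes D).

(* The length is any positive number: [:: x] is a cycle when there is a loop
   at x. *)
Definition directed_cycle D (c : seq T) : bool :=
  [&& 0 < size c, cycle (fun x y => (x, y) \in arcs D) c & uniq c].

Definition acyclic D : Prop := forall c, ~~ directed_cycle D c.

Definition is_dag D : Prop := is_digraph D /\ acyclic D.

Definition preds D (x : T) : {set T} :=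
  [set y in nodes D | (y, x) \in arcs D].

Fixpoint tau_rec D (n : nat) (x : T) : nat :=
  if n is n'.+1 then
    if preds D x == set0 then 0 else (\max_(y in preds D x) tau_rec D n' y).+1
  else 0.

(* The recursion is bounded by the number of nodes, which makes tau total; on
   DAGs the bound is never reached, see tauE below. *)
Definition tau D (x : T) : nat := tau_rec D #|nodes D| x.

Definition rev_Cx D a : {set T * T} :=
  let: (x, y) := a in
  [set (z, x) | z in (preds D y :\: preds D x) :\ x].

Definition rev_Cy D a : {set T * T} :=
  let: (x, y) := a in [set (z, y) | z in preds D x :\: preds D y].

Definition reverse_arc D a : digraph :=
  Digraph (nodes D)
    ((arcs D :|: rev_Cx D a :|: rev_Cy D a :|: [set (a.2, a.1)]) :\ a).

Fixpoint valid_reversals D (s : seq (T * T)) (D' : digraph) : Prop :=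
  if s is a :: s' then
    [/\ a \in arcs D, acyclic (reverse_arc D a)
      & valid_reversals (reverse_arc D a) s' D']
  else D' = D.

Lemma acyclic_rpath_uniq D x p :
  acyclic D -> path (fun u v => (v, u) \in arcs D) x p -> uniq (x :: p).
Proof.
move=> acD; elim: p x => // y p IHp x xyp.
have uyp : uniq (y :: p) by apply: IHp; case/andP: xyp.
rewrite cons_uniq uyp andbT; apply/negP => x_yp.
case/splitPr: x_yp xyp uyp => p1 p2 xp up.
have /negP[] := acD (rev (x :: p1)).
rewrite /directed_cycle size_rev /= rev_uniq rev_cycle /= rcons_path.
move: xp up; rewrite cat_path cat_uniq /= => /andP[-> /andP[-> _]].
by case/and3P=> -> /norP[-> _] _.
Qed.

Lemma tau_rec_stable D n x :
  tau_rec D n x < n -> tau_rec D n.+1 x = tau_rec D n x.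
Proof.
elim: n x => // n IHn x; rewrite [tau_rec D n.+2 x]/= [tau_rec D n.+1 x]/=.
case: ifP => // _; rewrite ltnS => lt_n; congr _.+1.
apply: eq_bigr => y xy; apply: IHn; apply: leq_ltn_trans lt_n.
exact: (@leq_bigmax_cond _ _ (tau_rec D n) y xy).
Qed.

Lemma tau_rec_path D n x : n <= tau_rec D n x ->
  exists2 p, size p = n & path (fun u v => (v, u) \in arcs D) x p.
Proof.
elim: n x => [|n IHn] x /=; first by exists [::].
case: ifP => // /negbT/set0Pn[y0 xy0]; rewrite ltnS.
have P0 : 0 < #|preds D x| by apply/card_gt0P; exists y0.
have [y xy ->] := eq_bigmax_cond (tau_rec D n) P0.
case/IHn=> p szp yp; exists (y :: p); rewrite /= ?szp // yp andbT.
by move: xy; rewrite inE => /andP[].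
Qed.

Lemma tauE D x : is_dag D ->
  tau D x =
    if preds D x == set0 then 0 else (\max_(y in preds D x) tau D y).+1.
Proof.
case=> wfD acD; rewrite -[RHS]/(tau_rec D #|nodes D|.+1 x).
have [lt|] := ltnP (tau_rec D #|nodes D| x) #|nodes D|.
  by rewrite tau_rec_stable.
have [P0 _|/set0Pn[y]] := eqVneq (preds D x) set0.
  by rewrite /tau /= P0 eqxx; case: #|_| => //= n; rewrite P0 eqxx.
rewrite inE => /andP[_ /(subsetP wfD)]; rewrite inE /= => /andP[_ xV].
case/tau_rec_path=> p szp xp.
have := acyclic_rpath_uniq acD xp => /card_uniqP /= cardp.
suff /subset_leq_card : x :: p \subset nodes D by rewrite cardp szp ltnn.
apply/subsetP => z; rewrite inE => /predU1P[-> //|].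
elim: p {szp cardp y} x xV xp => // y p IHp x _ /= /andP[yx yp].
have yV : y \in nodes D by have := subsetP wfD _ yx; rewrite inE => /andP[].
by rewrite inE => /predU1P[-> //|]; apply: IHp yV yp.
Qed.

End Digraphs.

Section FuseDags.

Variable T : finType.

Implicit Types (D : digraph T) (a b : T * T).

Record state := State {
  Dstar : digraph T;
  Dtwo : digraph T;
  DIR : {set T * T};
  REV : {set T * T};
  EQ : {set T * T}
}.

Definition add_arcs D (A : {set T * T}) : digraph T :=
  Digraph (nodes D) (arcs D :|: A).

Definition init D1 D2 : state :=
  let Ds := Digraph (nodes D1 :|: nodes D2) (arcs D1) in
  State Ds D2
    [set a in arcs D2 | (a \notin arcs Ds) && (tau Ds a.1 < tau Ds a.2)]
    [set a in arcs D2 | tau Ds a.1 > tau Ds a.2]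
    [set a in arcs D2 | tau Ds a.1 == tau Ds a.2].

(* The priority orders are total preorders. *)
Definition le_REV D2 a b : bool :=
  (tau D2 a.2 < tau D2 b.2)
  || (tau D2 a.2 == tau D2 b.2) && (tau D2 a.1 >= tau D2 b.1).

Definition le_EQ Ds D2 a b : bool :=
  (tau Ds a.1 > tau Ds b.1)
  || (tau Ds a.1 == tau Ds b.1) && (tau D2 a.2 >= tau D2 b.2).

(* Nothing in A is strictly below a; several elements may be minimal. *)
Definition minimal (le : rel (T * T)) (A : {set T * T}) a : Prop :=
  a \in A /\ forall b, b \in A -> le b a -> le a b.

Definition first_loop_body (s : state) a : state :=
  let Ds := add_arcs (Dstar s) [set (a.2, a.1)] in
  let C := rev_Cx (Dtwo s) a :|: rev_Cy (Dtwo s) a in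
  State Ds (reverse_arc (Dtwo s) a)
    (DIR s :|: [set b in C | tau Ds b.1 < tau Ds b.2])
    ((REV s :\ a) :|: [set b in C | tau Ds b.1 > tau Ds b.2])
    (EQ s :|: [set b in C | tau Ds b.1 == tau Ds b.2]).

Definition flush_DIR (s : state) : state :=
  State (add_arcs (Dstar s) (DIR s)) (Dtwo s) set0 (REV s) (EQ s).

Definition add_EQ_arc (s : state) a : state :=
  let EQ' := EQ s :\ a in
  let new_DIR := [set b in EQ' | b.2 == a.2] in
  State (add_arcs (Dstar s) [set a]) (Dtwo s)
    new_DIR (REV s) (EQ' :\: new_DIR).

(* SecondLoopSelect is the point inside an iteration of the second loop
   between the addition of DIR to D* and the selection of an arc of EQ. *)
Inductive program_point :=
  FirstLoop | SecondLoop | SecondLoopSelect | Done.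

(* execution D1 D2 p s rs: some execution on input (D1, D2), i.e. for some way
   of breaking ties, reaches the program point p in the state s, after having
   reversed the arcs rs of D2, in this order. *)
Inductive execution D1 D2 :
    program_point -> state -> seq (T * T) -> Prop :=
| exec_init :
    execution D1 D2 FirstLoop (init D1 D2) [::]
| exec_first_iter s rs a :
    execution D1 D2 FirstLoop s rs ->
    minimal (le_REV (Dtwo s)) (REV s) a ->
    execution D1 D2 FirstLoop (first_loop_body s a) (rcons rs a)
| exec_first_exit s rs :
    execution D1 D2 FirstLoop s rs ->
    REV s = set0 ->
    execution D1 D2 SecondLoop s rs
| exec_second_flush s rs :
    execution D1 D2 SecondLoop s rs ->
    ~ (EQ s = set0 /\ DIR s = set0) ->
    execution D1 D2 SecondLoopSelect (flush_DIR s) rs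
| exec_second_select s rs a :
    execution D1 D2 SecondLoopSelect s rs ->
    minimal (le_EQ (Dstar s) (Dtwo s)) (EQ s) a ->
    execution D1 D2 SecondLoop (add_EQ_arc s a) rs
| exec_second_skip s rs :
    execution D1 D2 SecondLoopSelect s rs ->
    EQ s = set0 ->
    execution D1 D2 SecondLoop s rs
| exec_second_exit s rs :
    execution D1 D2 SecondLoop s rs ->
    EQ s = set0 -> DIR s = set0 ->
    execution D1 D2 Done s rs.

End FuseDags.

(* Main.v *)
Require Import Defs.
From mathcomp Require Import all_boot zify.

Set Implicit Arguments.
Unset Strict Implicit.
Unset Printing Implicit Defensive.

(** Let [t] be the topological value of the initial [Dstar].  Every arc added
    to [Dstar] by the first loop increases [t], so [t] remains its topological
    value and [REV] is always the set of arcs of [Dtwo] that decrease [t].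
    Reversing an arc [(x, y)] of [Dtwo] creates a cycle only if there is a path
    from [x] to [y] through a predecessor [w != x] of [y].  If [(x, y)] is
    minimal, no arc of the path from [x] to [w] is in [REV], so
    [t y < t x <= t w] and [(w, y)] is in [REV], with priority over [(x, y)].
    In the second loop [Dtwo] is fixed, and every arc of [Dstar], [DIR] and [EQ]
    increases the pair ([t], topological value in [Dtwo]) lexicographically. *)

(** * Topological values and acyclic arc reversal in a digraph *)

Section Digraphs.

Variable T : finType.
Implicit Types (D : digraph T) (x y z : T).

Lemma acyclic_sub_order D (r : rel T) :
    irreflexive r -> transitive r ->
    (forall x y, (x, y) \in arcs D -> r x y) ->
  acyclic D.
Proof.
move=> r_irr r_tr arc_r [//|x p]; apply/negP => /and3P[_ /= xpx _].
have /(order_path_min r_tr) : path r x (rcons p x) by apply: sub_path xpx.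
by rewrite all_rcons r_irr.
Qed.

Lemma arc_nodes D x y :
  is_digraph D -> (x, y) \in arcs D -> (x \in nodes D) && (y \in nodes D).
Proof. by move=> /subsetP wfD /wfD; rewrite inE. Qed.

Lemma mem_preds D x y :
  is_digraph D -> (y \in preds D x) = ((y, x) \in arcs D).
Proof.
move=> wfD; rewrite inE andb_idl // => yx.
by case/andP: (arc_nodes wfD yx).
Qed.

Lemma tau_lt D x y : is_dag D -> (x, y) \in arcs D -> tau D x < tau D y.
Proof.
move=> dagD xy; have Pyx : x \in preds D y by rewrite mem_preds //; case: dagD.
rewrite (tauE y dagD) ifN; last by apply/set0Pn; exists x.
by rewrite ltnS (@leq_bigmax_cond _ _ (tau D)).
Qed.

(** By strong induction on [tau D x]: old and new predecessors of [x] all have a smaller [tau D], so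
    the maximum in the recursion does not change. *)
Lemma tau_add_arcs D (A : {set T * T}) :
    is_dag D -> is_dag (add_arcs D A) ->
    {in A, forall a, tau D a.1 < tau D a.2} ->
  tau (add_arcs D A) =1 tau D.
Proof.
move=> dagD dagD' incA x; have [n] := ubnP (tau D x).
elim: n x => // n IHn x; rewrite ltnS => le_n.
have lt_x y : y \in preds (add_arcs D A) x -> tau D y < tau D x.
  by rewrite !inE => /andP[_] /orP[/(tau_lt dagD) | /incA].
have subP : preds D x \subset preds (add_arcs D A) x.
  by apply/subsetP => y; rewrite !inE => /andP[-> ->].
have IHy y : y \in preds (add_arcs D A) x -> tau (add_arcs D A) y = tau D y.
  by move=> /lt_x lt_yx; apply: IHn; lia.
rewrite (tauE x dagD'); case: ifP => [/eqP P0 | /negbT/set0Pn[y0 y0x]].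
  by move: subP; rewrite P0 subset0 (tauE x dagD) => ->.
rewrite (eq_bigr _ IHy); apply/eqP; rewrite eqn_leq; apply/andP; split.
  have /card_gt0P P0 : exists y, y \in preds (add_arcs D A) x by exists y0.
  by have [y /lt_x lt_yx ->] := eq_bigmax_cond (tau D) P0.
move: (lt_x _ y0x); rewrite (tauE x dagD); case: ifP => // _ _.
by rewrite ltnS; apply/bigmax_leqP => y /(subsetP subP) yx;
  rewrite (@leq_bigmax_cond _ _ (tau D)).
Qed.

Lemma is_dag_add_increasing_arcs D (A : {set T * T}) :
    is_dag D -> A \subset setX (nodes D) (nodes D) ->
    {in A, forall a, tau D a.1 < tau D a.2} ->
  is_dag (add_arcs D A).
Proof.
move=> dagD sA incA; split.
  by rewrite /is_digraph subUset sA andbT; case: dagD.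
apply: (@acyclic_sub_order _ (relpre (tau D) ltn)) => [x|y x z|x y] /=.
- exact: ltnn.
- exact: ltn_trans.
- by rewrite inE => /orP[/(tau_lt dagD) | /incA].
Qed.

Lemma mem_rev_arcs D x y u v : is_digraph D ->
  ((u, v) \in rev_Cx D (x, y) :|: rev_Cy D (x, y)) =
    [&& v == x, (u, y) \in arcs D, (u, x) \notin arcs D & u != x]
    || [&& v == y, (u, x) \in arcs D & (u, y) \notin arcs D].
Proof.
move=> wfD; rewrite inE; congr (_ || _).
  apply/imsetP/and4P => [[z + [-> ->]] | [/eqP-> uy ux u'x]].
    by rewrite !in_setD !mem_preds // in_set1 => /and3P[-> -> ->].
  by exists u => //; rewrite !in_setD !mem_preds // in_set1 u'x ux uy.
apply/imsetP/and3P => [[z + [-> ->]] | [/eqP-> ux uy]].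
  by rewrite !in_setD !mem_preds // => /andP[-> ->].
by exists u => //; rewrite !in_setD !mem_preds // ux uy.
Qed.

Lemma mem_reverse_arc D x y b :
  (b \in arcs (reverse_arc D (x, y))) =
    (b != (x, y)) &&
    [|| b \in arcs D, b \in rev_Cx D (x, y) :|: rev_Cy D (x, y) | b == (y, x)].
Proof. by rewrite !inE -!orbA. Qed.

(** The last hypothesis says that the arc [(x, y)] is the only path from [x] to [y]. The numbering
    [f] below then increases along every arc of the new graph. *)
Lemma is_dag_reverse_arc D x y :
    is_dag D -> (x, y) \in arcs D ->
    (forall w, connect (fun u v => (u, v) \in arcs D) x w ->
       (w, y) \in arcs D -> w = x) ->
  is_dag (reverse_arc D (x, y)).
Proof.
move=> dagD xy uniq_path; have [wfD acD] := dagD.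
have /andP[xV yV] := arc_nodes wfD xy.
have arc_lt u v : (u, v) \in arcs D -> tau D u < tau D v by exact: tau_lt.
have arcxx u : (u, u) \notin arcs D by apply/negP => /arc_lt; rewrite ltnn.
split.
  apply/subsetP => -[u v]; rewrite mem_reverse_arc mem_rev_arcs // in_setX /=.
  case/andP=> _ /or3P[/(arc_nodes wfD)// | | /eqP[-> ->]]; last by rewrite xV yV.
  by case/orP=> [/and4P[/eqP-> /(arc_nodes wfD)/andP[-> _]] |
                 /and3P[/eqP-> /(arc_nodes wfD)/andP[-> _]]].
pose e u v := (u, v) \in arcs D.
have conn_le u v : connect e u v -> tau D u <= tau D v.
  case/connectP=> p; elim: p u => [|w p IHp] u /= => [_ -> //|].
  by case/andP=> /arc_lt/ltnW le_uw /IHp H /H; apply: leq_trans.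
pose anc v := [&& v != x, v != y & connect e v x || connect e v y].
pose N := (\max_v tau D v).+1.
have ltN v : tau D v < N by rewrite ltnS (leq_bigmax (F := tau D)).
(* Linearly order D with the proper ancestors of x and y first, then y, x and
   the other nodes. *)
pose f v := if v == x then N.+1 else if v == y then N else
            if anc v then tau D v else N.+2 + tau D v.
have x'y : x != y by apply: contraTneq xy => ->.
(* Every arc into [x] or [y], other than [(x, y)] and [(y, x)], starts at a node of [anc], in the
   old graph and in the new one. *)
have anc_x u : (u, x) \in arcs D -> anc u.
  move=> ux; apply/and3P; split; first by apply: contraTneq ux => ->.
    by apply/eqP => uy; have := arc_lt _ _ xy; have := arc_lt _ _ ux; rewrite uy; lia.
  by rewrite connect1.
have anc_y u : (u, y) \in arcs D -> u != x -> anc u.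
  move=> uy u'x; apply/and3P; split=> //; first by apply: contraTneq uy => ->.
  by rewrite [connect e u y]connect1 ?orbT.
(* [anc] is closed under predecessors; the uniqueness of the path is needed to exclude [u = x]. *)
have anc_arc u v : anc v -> (u, v) \in arcs D -> anc u.
  case/and3P=> v'x v'y cv uv; have cvy : connect e v y.
    by case/orP: cv => // /connect_trans; apply; apply: connect1.
  apply/and3P; split.
  - apply/eqP => ux; subst u; case/orP: cv => [/conn_le | _].
      by have := arc_lt _ _ uv; lia.
    (* The node before [y] on a path from [v] would have to be [x], but [tau D] is larger on that
       path than at [x]. *)
    case/connectP: cvy; case/lastP=> [_ /= yv|p z]; first by rewrite yv eqxx in v'y.
    rewrite rcons_path last_rcons => /andP[vp /[swap] <-] lasty.
    have cvw : connect e v (last v p) by apply/connectP; exists p.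
    have := uniq_path _ (connect_trans (connect1 uv) cvw) lasty.
    by move=> wx; have := conn_le _ _ cvw; have := arc_lt _ _ uv; rewrite wx; lia.
  - by apply/eqP => uy; have := conn_le _ _ cvy; have := arc_lt _ _ uv; rewrite uy; lia.
  - by rewrite (connect_trans (connect1 uv) cvy) orbT.
have fx : f x = N.+1 by rewrite /f eqxx.
have fy : f y = N by rewrite /f eq_sym (negbTE x'y) eqxx.
have f_anc u : anc u -> f u < N.
  by rewrite /f => ancu; case/and3P: (ancu) => /negbTE-> /negbTE-> _; rewrite ancu.
apply: (@acyclic_sub_order _ (relpre f ltn)) => [u|v u w|u v] /=.
- exact: ltnn.
- exact: ltn_trans.
rewrite mem_reverse_arc mem_rev_arcs // -orbA.
case/andP=> uv'xy /or4P[uv | /and4P[/eqP-> uy _ u'x] | /and3P[/eqP-> ux _] | /eqP[-> ->]].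
- have [vx|v'x] := eqVneq v x.
    by rewrite vx fx in uv *; have := f_anc _ (anc_x _ uv); lia.
  have [vy|v'y] := eqVneq v y.
    have u'x : u != x by apply: contraNneq uv'xy => ->; rewrite vy.
    by rewrite vy fy in uv *; exact: f_anc (anc_y _ uv u'x).
  (* If [anc v], both ends are numbered by [tau D]. Otherwise [f v] is at least [N.+2], above [y],
     [x] and all of [anc], and [tau D] decides for the remaining [u]. *)
  have := arc_lt _ _ uv; rewrite {2}/f (negbTE v'x) (negbTE v'y).
  case: ifP => [ancv|_]; rewrite /f.
    have ancu := anc_arc _ _ ancv uv.
    by case/and3P: (ancu) => /negbTE-> /negbTE-> _; rewrite ancu.
  by have := ltN u; do ?case: ifP => _; lia.
- by rewrite fx; have := f_anc _ (anc_y _ uy u'x); lia.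
- by rewrite fy; exact: f_anc (anc_x _ ux).
- by rewrite fx fy.
Qed.

(** [valid_reversals] recurses from the first reversal, whereas an execution appends the latest
    one. *)
Lemma valid_reversals_rcons D D' s a :
    valid_reversals D s D' -> a \in arcs D' -> acyclic (reverse_arc D' a) ->
  valid_reversals D (rcons s a) (reverse_arc D' a).
Proof.
elim: s D => [|b s IHs] D /= => [-> //|[bD acb /IHs IH aD' aca]].
by split; auto.
Qed.

End Digraphs.

(** * Invariants of the two loops *)

Section FuseDags.

Variables (T : finType) (D2 : digraph T) (t : T -> nat).
Implicit Types (s : state T) (rs : seq (T * T)).

(** [REV] is characterized exactly, because minimality must be tested against every arc of [Dtwo]
    that decreases [t]. For [DIR] and [EQ] an inclusion suffices. *)
Record first_inv s rs : Prop := FirstInv {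
  first_dag_star : is_dag (Dstar s);
  first_tau_star : tau (Dstar s) =1 t;
  first_dag_two : is_dag (Dtwo s);
  first_nodes : nodes (Dtwo s) \subset nodes (Dstar s);
  first_DIR : {in DIR s, forall a, a \in arcs (Dtwo s) /\ t a.1 < t a.2};
  first_REV : forall a, (a \in REV s) = (a \in arcs (Dtwo s)) && (t a.2 < t a.1);
  first_EQ : {in EQ s, forall a, a \in arcs (Dtwo s) /\ t a.1 = t a.2};
  first_valid : valid_reversals D2 rs (Dtwo s)
}.

Lemma first_inv_unique_path s rs x y w :
    first_inv s rs -> minimal (le_REV (Dtwo s)) (REV s) (x, y) ->
    connect (fun u v => (u, v) \in arcs (Dtwo s)) x w ->
    (w, y) \in arcs (Dtwo s) ->
  w = x.
Proof.
move=> inv [xyR min_xy] /connectP[p xp ->{w}] wy.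
have dagD := first_dag_two inv; set D := Dtwo s in xp wy min_xy dagD *.
have tau_last z q : path (fun u v => (u, v) \in arcs D) z q ->
    tau D z + size q <= tau D (last z q).
  elim: q z => [|v q IHq] z /=; first by rewrite addn0.
  by case/andP=> /(tau_lt dagD) zv /IHq; lia.
(* An arc of the path that decreases [t] would be in [REV] with a head of [tau] below [tau D y],
   hence strictly before [(x, y)]. *)
have t_last z q : path (fun u v => (u, v) \in arcs D) z q ->
    tau D (last z q) < tau D y -> t z <= t (last z q).
  elim: q z => //= v q IHq z /andP[zv vq] lt_y; apply: leq_trans (IHq _ vq lt_y).
  rewrite leqNgt; apply/negP => lt_vz.
  have zvR : (z, v) \in REV s by rewrite (first_REV inv) zv.
  have lt_vy : tau D v < tau D y by have := tau_last _ _ vq; lia.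
  by have := min_xy _ zvR; rewrite /le_REV /=; lia.
have wR : (last x p, y) \in REV s.
  move: xyR; rewrite !(first_REV inv) wy /= => /andP[_ lt_yx].
  by apply: leq_trans (t_last _ _ xp (tau_lt dagD wy)).
(* Both arcs have head [y], so minimality gives [tau D (last x p) <= tau D x], which forces [p] to
   be empty. *)
have := min_xy _ wR; have := tau_last _ _ xp.
by rewrite /le_REV /=; case: p {xp wy wR} => //= v p; lia.
Qed.

Lemma first_inv_body s rs a :
    first_inv s rs -> minimal (le_REV (Dtwo s)) (REV s) a ->
  first_inv (first_loop_body s a) (rcons rs a).
Proof.
case: a => x y inv min_xy.
have [xy lt_yx] : (x, y) \in arcs (Dtwo s) /\ t y < t x.
  by case: min_xy => + _; rewrite (first_REV inv) => /andP[].
have [wfD _] := first_dag_two inv.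
have dagD' : is_dag (reverse_arc (Dtwo s) (x, y)).
  apply: is_dag_reverse_arc (first_dag_two inv) xy _ => w.
  exact: first_inv_unique_path inv min_xy.
have inc_yx : {in [set (y, x)], forall a,
    tau (Dstar s) a.1 < tau (Dstar s) a.2}.
  by move=> _ /set1P->; rewrite !(first_tau_star inv).
have dagDs : is_dag (add_arcs (Dstar s) [set (y, x)]).
  apply: is_dag_add_increasing_arcs inc_yx; first exact: first_dag_star inv.
  rewrite sub1set in_setX /=; have /andP[xV yV] := arc_nodes wfD xy.
  by rewrite !(subsetP (first_nodes inv)).
(* Hence the loop body sorts the new arcs by comparing values of [t]. *)
have tauDs : tau (add_arcs (Dstar s) [set (y, x)]) =1 t.
  move=> z; rewrite -(first_tau_star inv).
  exact: tau_add_arcs (first_dag_star inv) dagDs inc_yx z.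
have new_arc b : b \in rev_Cx (Dtwo s) (x, y) :|: rev_Cy (Dtwo s) (x, y) ->
    b \in arcs (reverse_arc (Dtwo s) (x, y)).
  rewrite mem_reverse_arc => bC; rewrite bC orbT andbT.
  by apply: contraTneq bC => ->; rewrite mem_rev_arcs // eqxx xy !andbF.
have old_arc b : b \in arcs (Dtwo s) -> b != (x, y) ->
    b \in arcs (reverse_arc (Dtwo s) (x, y)).
  by move=> bD b'xy; rewrite mem_reverse_arc bD b'xy.
split=> //=.
- exact: first_nodes inv.
- move=> b; rewrite in_setU [in X in _ || X]inE !tauDs.
  case/orP=> [/(first_DIR inv)[bD lt_b] | /andP[/new_arc]//].
  by split=> //; apply: old_arc => //; apply: contraTneq lt_b => -> /=; lia.
- move=> b; rewrite in_setU in_setD1 [in X in _ || X]inE !tauDs.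
  rewrite (first_REV inv) mem_reverse_arc.
  set C := _ :|: _; have [-> | b'xy /=] := eqVneq b (x, y).
    by rewrite mem_rev_arcs // eqxx xy !andbF.
  (* The reversed arc [(y, x)] increases [t], so it does not belong in [REV]. *)
  rewrite -andb_orl orbA; have [->|_] := eqVneq b (y, x) => /=; first lia.
  by rewrite orbF.
- move=> b; rewrite in_setU [in X in _ || X]inE !tauDs.
  case/orP=> [/(first_EQ inv)[bD eq_b] | /andP[/new_arc bD' /eqP]//].
  split=> //; apply: old_arc => //; apply/eqP => b_xy.
  by move: eq_b lt_yx; rewrite b_xy /= => ->; rewrite ltnn.
- by apply: valid_reversals_rcons (first_valid inv) xy _; case: dagD'.
Qed.

Definition lexi_lt D : rel T :=
  fun x y => (t x < t y) || (t x == t y) && (tau D x < tau D y).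

(** The second loop only moves arcs between [Dstar], [DIR] and [EQ], so one condition on their union
    is preserved by mere inclusion. *)
Record second_inv s rs : Prop := SecondInv {
  second_acyclic_two : acyclic (Dtwo s);
  second_arcs : forall x y,
    (x, y) \in arcs (Dstar s) :|: DIR s :|: EQ s -> lexi_lt (Dtwo s) x y;
  second_valid : valid_reversals D2 rs (Dtwo s)
}.

(** Arcs of [Dstar] and [DIR] increase [t]; arcs of [EQ] preserve [t] and, being arcs of the DAG
    [Dtwo], increase its [tau]. *)
Lemma first_second_inv s rs : first_inv s rs -> second_inv s rs.
Proof.
move=> inv; have dagD := first_dag_two inv.
split; [by case: dagD | | exact: first_valid inv].
move=> x y; rewrite !inE -orbA /lexi_lt => /or3P[xy | xy | xy].
- by rewrite -!(first_tau_star inv) (tau_lt (first_dag_star inv) xy).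
- by case: (first_DIR inv xy) => _ /= ->.
- by case: (first_EQ inv xy) => /(tau_lt dagD)-> /= ->; rewrite eqxx orbT.
Qed.

Lemma second_inv_mono s s' rs :
    second_inv s rs -> Dtwo s' = Dtwo s ->
    arcs (Dstar s') :|: DIR s' :|: EQ s' \subset arcs (Dstar s) :|: DIR s :|: EQ s ->
  second_inv s' rs.
Proof.
case=> acD incD valD eqD /subsetP sub_s.
by split; rewrite ?eqD // => x y /sub_s; apply: incD.
Qed.

Lemma second_inv_acyclic s rs : second_inv s rs -> acyclic (Dstar s).
Proof.
case=> _ incD _; apply: (@acyclic_sub_order _ _ (lexi_lt (Dtwo s))).
- by move=> x; rewrite /lexi_lt; lia.
- by move=> y x z; rewrite /lexi_lt; lia.
- by move=> x y xy; apply: incD; rewrite !inE xy.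
Qed.

End FuseDags.

(** * Invariants along an execution *)

Lemma first_inv_init (T : finType) (D1 D2 : digraph T) :
    is_dag D1 -> is_dag D2 ->
  first_inv D2 (tau (Dstar (init D1 D2))) (init D1 D2) [::].
Proof.
move=> [wfD1 acD1] dagD2; split=> //=; first split=> //.
- by apply: subset_trans wfD1 _; apply: setXS; apply: subsetUl.
- exact: subsetUr.
- by move=> a; rewrite inE => /and3P[].
- by move=> a; rewrite inE.
- by move=> a; rewrite inE => /andP[? /eqP].
Qed.

Lemma execution_inv (T : finType) (D1 D2 : digraph T) p s rs :
    is_dag D1 -> is_dag D2 -> execution D1 D2 p s rs ->
  let t := tau (Dstar (init D1 D2)) in
  if p is FirstLoop then first_inv D2 t s rs else second_inv D2 t s rs.
Proof.
move=> dagD1 dagD2 /=.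
elim=> {p s rs} [|s rs a _ inv min_a|s rs _ inv _|s rs _ inv _|s rs a _ inv [aE _]|//|//].
- exact: first_inv_init.
- exact: first_inv_body.
- exact: first_second_inv.
- by apply: second_inv_mono inv _ _ => //=; rewrite setU0.
- apply: second_inv_mono inv _ _ => //=; apply/subsetP => b.
  (* The selected arc, the new [DIR] and the new [EQ] all come from the old [EQ]. *)
  by rewrite !inE => /orP[/orP[/orP[->|/eqP->] | /andP[/andP[_ ->]]] | /and3P[_ _ ->]];
    rewrite ?aE ?orbT.
Qed.

Theorem theorem1 (T : finType) (D1 D2 : digraph T)
    (hD1 : is_dag D1) (hD2 : is_dag D2) :
  (forall (p : program_point) (s : state T) (rs : seq (T * T)),
     execution D1 D2 p s rs -> acyclic (Dstar s) /\ acyclic (Dtwo s)) /\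
  (forall (p : program_point) (s : state T) (rs : seq (T * T)),
     execution D1 D2 p s rs -> valid_reversals D2 rs (Dtwo s)).
Proof.
have inv p s rs : execution D1 D2 p s rs ->
    second_inv D2 (tau (Dstar (init D1 D2))) s rs.
  by move/(execution_inv hD1 hD2); case: p => //; apply: first_second_inv.
split=> p s rs /inv sinv; last exact: second_valid sinv.
by split; [exact: second_inv_acyclic sinv | exact: second_acyclic_two sinv].
Qed.
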